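(* For every $\sigma\in[0,1)$, $F_{3,3}$ is the unique $A_\sigma$-minimizer graph in $\mathcal{G}_{6,2}$.
   Context: All graphs are finite, simple and connected. $A_\sigma(G)=\sigma D(G)+(1-\sigma)A(G)$ where $A(G)$ is the adjacency matrix and $D(G)$ the diagonal degree matrix; $\lambda_\sigma(G)$ is its largest eigenvalue. $\mathcal{G}_{n,\alpha}$ is the family of connected $n$-vertex graphs with independence number $\alpha$; an $A_\sigma$-minimizer graph attains the minimum of $\lambda_\sigma$ over it. $F_{s,t}$ denotes the graph obtained from disjoint complete graphs $K_s$ and $K_t$ by adding one edge $uv$ with $u\in V(K_s)$, $v\in V(K_t)$. *)

(* Defs.v *)
From mathcomp Require Import all_boot all_order all_algebra.
From mathcomp Require Import classical_sets reals.

Set Implicit Arguments.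
Unset Strict Implicit.
Unset Printing Implicit Defensive.

Import Order.TTheory GRing.Theory Num.Theory.

Local Open Scope ring_scope.

Record sgraph := SGraph {
  vertex :> finType;
  adj : rel vertex;
  adj_sym : symmetric adj;
  adj_irr : irreflexive adj }.

Definition connected_graph (G : sgraph) : Prop :=
  forall x y : G, connect (@adj G) x y.

Definition degree (G : sgraph) (x : G) : nat := #|[pred y | adj x y]|.

Definition independent (G : sgraph) (S : {set G}) : bool :=
  [forall x in S, forall y in S, ~~ adj x y].

Definition independence_number (G : sgraph) : nat :=
  \max_(S : {set G} | independent S) #|S|.

Definition isomorphic (G H : sgraph) : Prop :=
  exists2 f : G -> H, bijective f & forall x y, adj (f x) (f y) = adj x y.

(* Rows and columns follow the enumeration of the vertices; another
   enumeration conjugates these matrices by a permutation matrix. *)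
Definition adjacency_mx (R : realType) (G : sgraph) : 'M[R]_#|G| :=
  \matrix_(i, j) (adj (enum_val i) (enum_val j))%:R.

Definition degree_mx (R : realType) (G : sgraph) : 'M[R]_#|G| :=
  diag_mx (\row_i (degree (enum_val i))%:R).

Definition A_mx (R : realType) (sigma : R) (G : sgraph) : 'M[R]_#|G| :=
  sigma *: degree_mx R G + (1 - sigma) *: adjacency_mx R G.

(* A_mx sigma G is a real symmetric matrix, so for a nonempty G its set of
   real eigenvalues is finite and nonempty, and this supremum is a maximum. *)
Definition lambda (R : realType) (sigma : R) (G : sgraph) : R :=
  sup [set a : R | eigenvalue (A_mx sigma G) a]%classic.

Definition in_family (n alpha : nat) (G : sgraph) : Prop :=
  [/\ connected_graph G, #|G| = n & independence_number G = alpha].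

Definition minimizer (R : realType) (sigma : R) (n alpha : nat)
    (G : sgraph) : Prop :=
  in_family n alpha G /\
  forall H : sgraph, in_family n alpha H -> lambda sigma G <= lambda sigma H.

(* The added edge joins the vertices numbered 0 of the two complete graphs;
   any other choice of endpoints gives an isomorphic graph. *)
Definition F_adj (s t : nat) : rel ('I_s + 'I_t)%type := fun x y =>
  match x, y with
  | inl i, inl j => i != j
  | inr i, inr j => i != j
  | inl i, inr j => (i == 0 :> nat) && (j == 0 :> nat)
  | inr j, inl i => (i == 0 :> nat) && (j == 0 :> nat)
  end.

Lemma F_adj_sym s t : symmetric (@F_adj s t).
Proof. by case=> i [] j //=; rewrite eq_sym. Qed.

Lemma F_adj_irr s t : irreflexive (@F_adj s t).
Proof. by case=> i /=; rewrite eqxx. Qed.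

Definition F_graph (s t : nat) : sgraph :=
  SGraph (@F_adj_sym s t) (@F_adj_irr s t).

(* Main.v *)
Require Import Defs.
From mathcomp Require Import all_boot all_order all_algebra.
From mathcomp Require Import classical_sets reals.
From mathcomp Require Import ring lra.
From mathcomp.real_closed Require Import complex.

(* Let t be the larger root of t^2 - (2 + 3 sigma) t - 1 + 7 sigma, the
   characteristic polynomial of the quotient matrix of F_{3,3} by its equitable
   partition (ends of the bridge, other vertices). A positive eigenvector gives
   lambda(F_{3,3}) = t, and 1 + sigma < t < (5 + sigma) / 2.
   A graph with independence number 2 has a triangle-free complement, so every
   non-neighborhood is a clique; splitting on the minimum degree, a connected
   such graph on 6 vertices is F_{3,3} or has at least 8 edges. In the latter
   case a Rayleigh quotient exceeds t: the vector 1 works for 9 or more edges,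
   1 + e_v for a vertex v of degree at least 4, and in the remaining case
   (8 edges, degrees 2 and 3) a vector that depends only on the degree. *)

Set Implicit Arguments.
Unset Strict Implicit.
Unset Printing Implicit Defensive.

(** * Graphs on six vertices with independence number 2 *)

Section Graphs.
Variable G : sgraph.
Implicit Types (u v w x y z : G) (s t : seq G).

Lemma mem_uniq_vertices s : uniq s -> size s = #|G| -> s =i G.
Proof.
move=> s_uniq s_size; apply/subset_cardP; last exact/fintype.subsetP.
by rewrite (card_uniqP _).
Qed.

Lemma big_uniq_vertices (V : nmodType) (F : G -> V) s :
  uniq s -> size s = #|G| -> (\sum_x F x = \sum_(x <- s) F x)%R.
Proof.
move=> s_uniq s_size; rewrite [RHS]big_uniq //; apply: eq_bigl => x.
by rewrite mem_uniq_vertices.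
Qed.

Lemma degree_uniq s v : uniq s -> size s = #|G| ->
  degree v = (\sum_(x <- s) adj v x)%N.
Proof.
move=> s_uniq s_size; rewrite -(big_uniq_vertices (fun x => adj v x : nat)) //.
by rewrite /degree -sum1_card big_mkcond.
Qed.

Lemma connected_cut (S : {pred G}) x y : connected_graph G ->
  x \in S -> y \notin S -> exists2 u, u \in S & exists2 w, w \notin S & adj u w.
Proof.
move=> connG xS yS.
have [/exists_inP[u uS /exists_inP[w wS uw]]|noedge] :=
  boolP [exists u in S, exists w in [predC S], adj u w].
  by exists u => //; exists w.
have closedS : closed (@adj G) S.
  apply: (intro_closed (sym_connect_sym (@adj_sym G))) => u w uw uS.
  apply: contraR noedge => wS; apply/exists_inP; exists u => //.
  by apply/exists_inP; exists w.
by move: yS; rewrite -(closed_connect closedS (connG x y)) xS.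
Qed.

Lemma independence_number2_adj x y z : independence_number G = 2 ->
  uniq [:: x; y; z] -> ~~ adj x y -> ~~ adj x z -> adj y z.
Proof.
move=> alpha2 xyz nxy nxz; apply/negPn/negP => nyz.
have : #|[set u in [:: x; y; z]]| <= 2.
  rewrite -alpha2; apply: leq_bigmax_cond.
  apply/forall_inP => u uS; apply/forall_inP => w wS.
  move: uS wS; rewrite !inE => /or3P[] /eqP-> /or3P[] /eqP->;
    by rewrite ?adj_irr // adj_sym.
by rewrite cardsE (card_uniqP xyz).
Qed.

(** Sorting the vertices by adjacency to [v] lets a case analysis on the lengths of [s] and [t] give
    a name to every vertex. *)
Lemma neighbor_split v : exists s t,
  [/\ uniq (v :: s ++ t), size (v :: s ++ t) = #|G|, size s = degree v,
      all (adj v) s & all (predC (adj v)) t].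
Proof.
pose N := [pred y | adj v y]; pose T := [pred y | (y != v) && ~~ adj v y].
have uniq_s : uniq (v :: enum N ++ enum T).
  rewrite /= mem_cat !mem_enum !inE adj_irr eqxx /= cat_uniq !enum_uniq andbT
    /=.
  by apply/hasPn => y; rewrite !mem_enum !inE => /andP[].
exists (enum N), (enum T); split => //.
- rewrite -(card_uniqP uniq_s); apply: eq_card => y.
  rewrite !inE mem_cat !mem_enum !inE.
  by case: eqVneq => //=; case: adj.
- by rewrite -cardE.
- by apply/allP => y; rewrite mem_enum.
- by apply/allP => y; rewrite mem_enum => /andP[].
Qed.

(** The bridge is [pq]. The 7 edges and 8 non-edges settle all 15 pairs, so the order of the list
    already determines the isomorphism. *)
Lemma isomorphic_F33 p a b q x y :
    #|G| = 6 -> uniq [:: p; a; b; q; x; y] ->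
    [&& adj p a, adj p b, adj a b, adj q x, adj q y, adj x y & adj p q] ->
    ~~ [|| adj p x, adj p y, adj a q, adj a x, adj a y, adj b q, adj b x
         | adj b y] ->
  isomorphic G (F_graph 3 3).
Proof.
move=> cardG uniq_s /and5P[pa pb ab qx /and3P[qy xy pq]].
rewrite !negb_or => /and5P[px py aq ax /and4P[ay bq bx bY]].
pose k (i : F_graph 3 3) : nat := match i with inl i => i | inr i => 3 + i end.
have k_inj : injective k.
  case=> i [] j eq_ij.
  - by congr inl; apply: ord_inj.
  - by have := ltn_ord i; rewrite [i : nat]eq_ij.
  - by have := ltn_ord j; rewrite -[j : nat]eq_ij.
  - by congr inr; apply: ord_inj; move/addnI: eq_ij.
pose g i := nth p [:: p; a; b; q; x; y] (k i).
have g_inj : injective g.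
  have k_lt i : k i < 6.
    by case: i => i; [apply: leq_trans (ltn_ord i) _ | rewrite ltn_add2l].
  by move=> i j /eqP; rewrite nth_uniq // => /eqP/k_inj.
have g_adj i j : adj (g i) (g j) = adj i j.
  have E := (pa, pb, ab, qx, qy, xy, pq, negbTE px, negbTE py, negbTE aq,
    negbTE ax, negbTE ay, negbTE bq, negbTE bx, negbTE bY, adj_irr).
  by case: i => [] [[|[|[|//]]] ?]; case: j => [] [[|[|[|//]]] ?];
    rewrite /g /= ?E // adj_sym ?E.
have [|f gK fK] := inj_card_bij g_inj.
  by rewrite cardG card_sum !card_ord.
exists f; first exact: Bijective fK gK.
by move=> u w; rewrite -g_adj !fK.
Qed.

Section SixVertices.
Variables v a b x y z : G.
Hypotheses (cardG : #|G| = 6) (uniq_s : uniq [:: v; a; b; x; y; z]).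

Let degE u : degree u =
  adj u v + (adj u a + (adj u b + (adj u x + (adj u y + adj u z)))).
Proof. by rewrite (degree_uniq _ uniq_s) // unlock /= addn0. Qed.

(** These rules write every pair in the order [v, a, b, x, y, z], leaving 15 adjacency booleans to
    be split on. *)
Let symE := (@adj_irr G, adj_sym a v, adj_sym b v, adj_sym x v, adj_sym y v,
  adj_sym z v, adj_sym b a, adj_sym x a, adj_sym y a, adj_sym z a, adj_sym x b,
  adj_sym y b, adj_sym z b, adj_sym y x, adj_sym z x, adj_sym z y).

Let sum_degE : \sum_(u : G) degree u =
  (adj v a + adj v b + adj v x + adj v y + adj v z + adj a b + adj a x +
   adj a y + adj a z + adj b x + adj b y + adj b z + adj x y + adj x z +
   adj y z).*2.
Proof.
rewrite (big_uniq_vertices (fun u => degree u) uniq_s) // unlock /= !degE.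
rewrite !symE -addnn /=; ring.
Qed.

Lemma sum_degree_even6 : ~~ odd (\sum_(u : G) degree u).
Proof. by rewrite sum_degE odd_double. Qed.

(** Meant for [v] of degree 1, whose non-neighbors form a [K_4]. The edge [va], the 6 edges of the
    clique and one edge from [a] to it make 8; the clique end of the last one has degree at least
    4. *)
Lemma pendant_K4 :
    adj v a -> [&& adj b x, adj b y, adj b z, adj x y, adj x z & adj y z] ->
    [|| adj a b, adj a x, adj a y | adj a z] ->
  16 <= \sum_(u : G) degree u /\ exists u : G, 4 <= degree u.
Proof.
move=> va /and5P[bx bY bz xy /andP[xz yz]] cut; split.
  rewrite sum_degE va bx bY bz xy xz yz.
  by move: cut; do 4 case: (adj a _); do 4 case: (adj v _).
by case/or4P: cut => cut; [exists b | exists x | exists y | exists z];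
  rewrite degE !symE cut ?bx ?bY ?bz ?xy ?xz ?yz;
  case: (adj v _).
Qed.

(** If [a] and [b] are not adjacent, each of [x], [y], [z] is adjacent to one of them, which gives
    at least 2 + 3 + 3 edges. Otherwise there are two disjoint triangles: a single edge between them
    gives [F_graph 3 3], two or more give 8 edges. *)
Lemma degree2_triangle :
    independence_number G = 2 -> adj v a -> adj v b ->
    ~~ [|| adj v x, adj v y | adj v z] -> [&& adj x y, adj x z & adj y z] ->
    [|| adj a x, adj a y, adj a z, adj b x, adj b y | adj b z] ->
  isomorphic G (F_graph 3 3) \/ 16 <= \sum_(u : G) degree u.
Proof.
move=> alphaG va vb; rewrite !negb_or => /and3P[vx vy vz] /and3P[xy xz yz] cut.
have triangleE := (va, vb, negbTE vx, negbTE vy, negbTE vz, xy, xz, yz).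
have [ab|nab] := boolP (adj a b); last first.
  have cover w : uniq [:: a; b; w] -> adj a w || adj b w.
    rewrite -implyNb => abw; apply/implyP => aw.
    exact: (independence_number2_adj alphaG abw).
  pose sub := mask_uniq uniq_s.
  right; move: (cover x (sub [:: false; true; true; true]))
    (cover y (sub [:: false; true; true; false; true]))
    (cover z (sub [:: false; true; true; false; false; true])).
  rewrite sum_degE !triangleE (negbTE nab).
  by do 3 case: (adj a _); do 3 case: (adj b _).
have [cut2|cut1] := leqP 2
  (adj a x + adj a y + adj a z + adj b x + adj b y + adj b z).
  right; rewrite sum_degE !triangleE ab.
  by move: cut2; do 3 case: (adj a _); do 3 case: (adj b _).
have uniq_perm s :
    (forall p, count p s = count p [:: v; a; b; x; y; z]) -> uniq s.
  by move=> /permP/perm_uniq ->.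
have iso p q r k l m := @isomorphic_F33 p q r k l m cardG.
(* One case for each possible bridge; its ends are the first and fourth arguments of [iso]. *)
left; case/or4P: cut => [e|e|e|/or3P[] e];
  [ apply: (iso a v b x y z) | apply: (iso a v b y x z)
  | apply: (iso a v b z x y) | apply: (iso b v a x y z)
  | apply: (iso b v a y x z) | apply: (iso b v a z x y) ];
  try (by apply: uniq_perm => p /=; ring); rewrite ?symE ?triangleE ?ab ?e //;
  by move: cut1; rewrite e;
    case: (adj a x) (adj a y) (adj a z) (adj b x) (adj b y)
    (adj b z) => [] [] [] [] [] [].
Qed.

End SixVertices.

Lemma F33_or_8_edges : in_family 6 2 G ->
  isomorphic G (F_graph 3 3) \/
  [\/ 16 <= \sum_(v : G) degree v /\ exists v : G, 4 <= degree v,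
      18 <= \sum_(v : G) degree v |
      \sum_(v : G) degree v = 16 /\ forall v : G, 2 <= degree v <= 3].
Proof.
move=> [connG cardG alphaG].
have v0 : G by case: (pickP (mem G)) => [//|/eq_card0]; rewrite cardG.
have [v _ minv] := arg_minnP (@degree G) (isT : xpredT v0).
have [d3|d_lt3] := leqP 3 (degree v).
  right; apply: Or32.
  rewrite -[18]/(6 * 3) -cardG -sum_nat_const; apply: leq_sum => w _.
  exact: leq_trans (minv w _).
have [s [t [uniq_st size_st size_s adj_s nadj_t]]] := neighbor_split v.
have clique_t : pairwise (@adj G) t.
  have := uniq_st; rewrite -cat_cons cat_uniq => /and3P[_ /hasPn st].
  rewrite uniq_pairwise.
  apply: (sub_in_pairwise (P := [in t])); last exact/allP.
  move=> y z yt zt /= yz; apply: (@independence_number2_adj v) => //.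
  - move: (st y yt) (st z zt); rewrite /= !inE !negb_or [v == _]eq_sym yz.
    by rewrite [v == _]eq_sym => /andP[-> _] /andP[-> _].
  - exact: (allP nadj_t).
  - exact: (allP nadj_t).
have sizeE : size s + size t = 5.
  by have := size_st; rewrite cardG /= size_cat => -[].
have [u us [w wt uw]] : exists2 u, u \in v :: s & exists2 w, w \in t & adj u w.
  have [y yt] : exists y, y \in t.
    case: (t) sizeE => [|y t' _]; last by exists y; rewrite mem_head.
    by rewrite size_s addn0 => d5; rewrite d5 in d_lt3.
  have [|u us [w wS uw]] :=
    connected_cut (x := v) (y := y) connG (mem_head v s).
    move: uniq_st; rewrite -cat_cons cat_uniq => /and3P[_ /hasPn ts _].
    exact: ts.
  exists u => //; exists w => //.
  have := mem_uniq_vertices uniq_st size_st w.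
  by rewrite -cat_cons mem_cat (negPf wS) /= => ->.
(* The edge leaving [v :: s] must start in [s], because [w] is not a neighbor of [v]. *)
have {us uw wt} cut : has (fun u => has (adj u) t) s.
  apply/hasP; exists u; last by apply/hasP; exists w.
  move: us uw; rewrite inE => /predU1P[-> vw|//].
  by have := allP nadj_t w wt; rewrite /= vw.
rewrite cardG in size_st.
(* An empty [s] contradicts [cut], and three or more neighbors contradict [d_lt3]; degrees 1 and 2
   remain. *)
case: s => [|a [|b [|? ?]]] // in size_s adj_s uniq_st size_st sizeE cut *;
  last by rewrite -size_s in d_lt3.
- right; apply: Or31.
  case: t => [|b [|x [|y [|z [|? ?]]]]] // in sizeE uniq_st size_st
    nadj_t clique_t cut *.
  apply: (@pendant_K4 v a b x y z) => //.
  - by move: adj_s => /andP[].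
  - by move: clique_t; rewrite /= !andbT -!andbA.
  - by move: cut; rewrite /= !orbF.
case: t => [|x [|y [|z [|? ?]]]] // in sizeE uniq_st size_st
  nadj_t clique_t cut *.
have odd_sum := sum_degree_even6 cardG uniq_st.
have [|||||iso|sum16] := @degree2_triangle v a b x y z cardG uniq_st alphaG.
- by case/andP: adj_s.
- by case/and3P: adj_s.
- by move: nadj_t; rewrite /= andbT !negb_or.
- by move: clique_t; rewrite /= !andbT -!andbA.
- by move: cut; rewrite /= !orbF -!orbA.
- by left.
right; have [/existsP|] := boolP [exists u : G, 4 <= degree u].
  by constructor.
rewrite negb_exists => /forallP max3.
have [|lt18] := leqP 18 (\sum_(u : G) degree u); first by constructor.
apply: Or33; split; last first.
  by move=> k; have := minv k isT; rewrite -size_s => -> /=;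
    rewrite leqNgt max3.
(* An even sum that is at least 16 and below 18 equals 16. *)
by move: odd_sum sum16 lt18; case: (\sum_u _) => // n; do 17 case: n => [|n] //.
Qed.

End Graphs.

(** * Eigenvalue bounds for real matrices *)

Import Order.TTheory GRing.Theory Num.Theory.
Local Open Scope ring_scope.

Local Notation norm2 v := ((v *m v^T) 0 0).

Lemma norm2_sum (R : comPzRingType) n (v : 'rV[R]_n) :
  norm2 v = \sum_i v 0 i ^+ 2.
Proof. by rewrite mxE; apply: eq_bigr => i _; rewrite mxE expr2. Qed.

Section Spectrum.
Import sesquilinear spectral.
Local Open Scope sesquilinear_scope.

(** Over the complex numbers [A] is Hermitian, so it is unitarily diagonalizable with real
    eigenvalues; [m] is the largest of them. *)
Lemma symmetric_rayleigh (R : rcfType) n (A : 'M[R]_n) :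
    (0 < n)%N -> A^T = A ->
  exists2 m, eigenvalue A m &
    forall v : 'rV_n, (v *m A *m v^T) 0 0 <= m * norm2 v.
Proof.
move=> n_gt0 symA.
pose toC := real_complex R; pose AC := map_mx toC A.
have hermA : AC \is hermsymmx.
  apply: realsym_hermsym.
    apply/is_hermitianmxP; rewrite expr0 scale1r map_mx_id //.
    by rewrite /AC map_trmx symA.
  by apply/mxOverP => i j; rewrite mxE complex_real.
pose P := spectralmx AC; pose d := spectral_diag AC.
have uP : P \is unitarymx by exact: spectral_unitarymx.
have defA : AC = P^t* *m diag_mx d *m P.
  rewrite -invmx_unitary //; apply/orthomx_spectralP.
  exact: hermitian_normalmx.
have dE i : d 0 i = toC (complex.Re (d 0 i)).
  rewrite /toC RRe_real //.
  by have /mxOverP := hermitian_spectral_diag_real hermA; exact.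
pose i0 := Ordinal n_gt0.
case: (@Order.TotalTheory.arg_maxP _ _ _ i0 xpredT
  (fun i => complex.Re (d 0 i)) isT).
move=> k _ maxk.
exists (complex.Re (d 0 k)).
  suff: eigenvalue AC (d 0 k) by rewrite dE /AC eigenvalue_map.
  apply/eigenvalueP.
  exists (row k P); last first.
    (* A zero row would make the unitary matrix [P] singular. *)
    apply: contraTneq (unitarymx_unit uP) => Pk0.
    rewrite unitmxE unitfE negbK; apply/det0P.
    exists (delta_mx 0 k); last by rewrite -rowE.
    apply/negP => /eqP/rowP/(_ k); rewrite !mxE !eqxx => /eqP.
    by rewrite oner_eq0.
  rewrite -/AC {1}defA -row_mul !mulmxA (unitarymxP uP) mul1mx.
  by rewrite mul_diag_mx; apply/rowP => j; rewrite !mxE.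
move=> v; rewrite -lecR rmorphM /=.
(* In the coordinates [w] of [v] in the eigenbasis, both quadratic forms are sums of squared moduli,
   weighted by the eigenvalues on the left and by the largest one on the right. *)
pose w := map_mx toC v *m P^t*.
have vC : (map_mx toC v)^t* = (map_mx toC v)^T.
  by apply/matrixP => i j; rewrite !mxE; apply: conjc_real.
have wt : w^t* = P *m (map_mx toC v)^T.
  by rewrite /w trmx_mul map_mxM trmxCK vC.
have -> : ((v *m A *m v^T) 0 0)%:C%C = \sum_i d 0 i * `|w 0 i| ^+ 2.
  transitivity ((w *m diag_mx d *m w^t*) 0 0).
    have -> : w *m diag_mx d *m w^t* = map_mx toC (v *m A *m v^T).
      by rewrite wt map_mxM map_trmx map_mxM -/AC defA /w !mulmxA.
    by rewrite [RHS]mxE.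
  rewrite mul_mx_diag mxE; apply: eq_bigr => i _.
  by rewrite !mxE normCK mulrAC mulrC mulrA.
have -> : (norm2 v)%:C%C = \sum_i `|w 0 i| ^+ 2.
  transitivity ((w *m w^t*) 0 0).
    have -> : w *m w^t* = map_mx toC (v *m v^T).
      by rewrite wt /w mulmxA mulmxKtV // map_mxM map_trmx.
    by rewrite [RHS]mxE.
  by rewrite mxE; apply: eq_bigr => i _; rewrite !mxE normCK.
rewrite mulr_sumr ler_sum // => i _.
by rewrite ler_wpM2r ?exprn_ge0 // dE lecR; apply: maxk.
Qed.

End Spectrum.

(* Comparing an eigenvector [v] with [w] at the index maximizing
   [`|v i| / w i] bounds its eigenvalue. *)
Lemma eigenvalue_le_positive (R : realFieldType) n (A : 'M[R]_n)
    (w : 'I_n -> R) (t a : R) :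
    (forall i j, 0 <= A i j) -> (forall i, 0 < w i) ->
    (forall j, \sum_i w i * A i j <= t * w j) ->
  eigenvalue A a -> a <= t.
Proof.
move=> A_ge0 w_gt0 Aw /eigenvalueP[v vA v_neq0].
have [i0 vi0] : exists i, v 0 i != 0 by apply/rV0Pn.
case: (@Order.TotalTheory.arg_maxP _ _ _ i0 xpredT
  (fun i => `|v 0 i| / w i) isT).
move=> k _ maxk.
have vk_gt0 : 0 < `|v 0 k| / w k.
  by apply: lt_le_trans (maxk i0 isT); rewrite divr_gt0 ?normr_gt0.
have vle i : `|v 0 i| <= `|v 0 k| / w k * w i.
  by rewrite -ler_pdivrMr //; apply: maxk.
rewrite (le_trans (ler_norm a)) //.
rewrite -(ler_pM2r vk_gt0) -(ler_pM2r (w_gt0 k)).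
rewrite -[leLHS]mulrA divfK ?gt_eqF // -normrM.
have -> : a * v 0 k = \sum_i v 0 i * A i k.
  by have /rowP/(_ k) := vA; rewrite !mxE => <-.
apply: le_trans (ler_norm_sum _ _ _) _.
apply: (@le_trans _ _ (\sum_i `|v 0 k| / w k * (w i * A i k))).
  by apply: ler_sum => i _;
    rewrite normrM mulrA (ger0_norm (A_ge0 i k)) ler_wpM2r.
by rewrite -mulr_sumr [leRHS]mulrAC [leRHS]mulrC ler_pM2l ?Aw.
Qed.

(* The quadratic form of [A_mx sigma G]: summing [sigma * x u ^+ 2] over the
   neighbors [v] of [u] produces the degree. *)
Definition A_form (R : realType) (sigma : R) (G : sgraph) (x : G -> R) : R :=
  \sum_u \sum_v (adj u v)%:R * (sigma * x u ^+ 2 + (1 - sigma) * (x u * x v)).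

Lemma big_enum_vertex (V : nmodType) (G : sgraph) (F : G -> V) :
  \sum_(i < #|G|) F (enum_val i) = \sum_x F x.
Proof.
rewrite (reindex _ (onW_bij _ (@enum_rank_bij G))).
by apply: eq_bigr => x _; rewrite enum_rankK.
Qed.

Lemma degree_sum (R : pzSemiRingType) (G : sgraph) (x : G) :
  (degree x)%:R = \sum_y (adj x y)%:R :> R.
Proof.
by rewrite -natr_sum /degree -sum1_card big_mkcond.
Qed.

(** * Upper and lower bounds on [lambda] *)

Section Lambda.
Variables (R : realType) (sigma : R) (G : sgraph).

Lemma A_mxE i j : A_mx sigma G i j =
  sigma * ((degree (enum_val i))%:R *+ (i == j)) +
  (1 - sigma) * (adj (enum_val i) (enum_val j))%:R.
Proof. by rewrite !mxE. Qed.

Lemma A_mx_sym : (A_mx sigma G)^T = A_mx sigma G.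
Proof.
apply/matrixP => i j; rewrite mxE !A_mxE adj_sym eq_sym.
by case: eqVneq => [->|].
Qed.

Lemma mul_A_mx (w : G -> R) j :
  \sum_i w (enum_val i) * A_mx sigma G i j =
  \sum_u (adj (enum_val j) u)%:R *
    (sigma * w (enum_val j) + (1 - sigma) * w u).
Proof.
under eq_bigr do rewrite A_mxE mulrDr.
under [RHS]eq_bigr do rewrite mulrDr.
rewrite !big_split /=; congr (_ + _); last first.
  rewrite -big_enum_vertex; apply: eq_bigr => i _.
  by rewrite adj_sym; ring.
rewrite -mulr_suml -degree_sum (bigD1 j) //= eqxx mulr1n big1 ?addr0.
  ring.
by move=> i /negPf->; rewrite mulr0n !mulr0.
Qed.

Lemma A_mx_form (x : G -> R) (v := \row_i x (enum_val i)) :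
  (v *m A_mx sigma G *m v^T) 0 0 = A_form sigma x.
Proof.
rewrite /A_form -big_enum_vertex mxE; apply: eq_bigr => j _.
rewrite !mxE; under eq_bigr do rewrite mxE.
rewrite mul_A_mx mulr_suml; apply: eq_bigr => u _; ring.
Qed.

(** The Rayleigh bound of [m], applied to an eigenvector, shows that [m] dominates every eigenvalue,
    so the supremum is attained at [m]. *)
Lemma lambda_max : (0 < #|G|)%N ->
  eigenvalue (A_mx sigma G) (lambda sigma G) /\
  forall v : 'rV_#|G|,
    (v *m A_mx sigma G *m v^T) 0 0 <= lambda sigma G * norm2 v.
Proof.
move=> G_gt0; have [m eig_m max_m] := symmetric_rayleigh G_gt0 A_mx_sym.
suff -> : lambda sigma G = m by [].
have ub_m : ubound [set a : R | eigenvalue (A_mx sigma G) a]%classic m.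
  move=> a /= /eigenvalueP[v vA v_neq0].
  have [i vi] : exists i, v 0 i != 0 by apply/rV0Pn.
  have v_gt0 : 0 < norm2 v.
    rewrite norm2_sum (bigD1 i) //= ltr_pwDl ?exprn_even_gt0 //.
    by rewrite sumr_ge0 // => j _; rewrite sqr_ge0.
  have := max_m v; rewrite vA -scalemxAl mxE.
  by rewrite ler_pM2r.
apply/eqP; rewrite eq_le; apply/andP; split.
  by apply: ge_sup => //; exists m.
by apply: ub_le_sup => //; exists m.
Qed.

Lemma lambda_rayleigh (x : G -> R) : (0 < #|G|)%N ->
  A_form sigma x <= lambda sigma G * \sum_v x v ^+ 2.
Proof.
move=> /lambda_max[_ /(_ (\row_i x (enum_val i)))].
rewrite A_mx_form norm2_sum -big_enum_vertex.
by under eq_bigr do rewrite mxE.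
Qed.

(** A Collatz-Wielandt bound; [0 <= sigma <= 1] makes the entries of the matrix nonnegative. *)
Lemma lambda_le (w : G -> R) (t : R) : 0 <= sigma <= 1 -> (0 < #|G|)%N ->
    (forall v, 0 < w v) ->
    (forall v, \sum_u (adj v u)%:R * (sigma * w v + (1 - sigma) * w u)
       <= t * w v) ->
  lambda sigma G <= t.
Proof.
move=> /andP[s_ge0 s_le1] /lambda_max[eig _] w_gt0 ww.
apply: (eigenvalue_le_positive (w := fun i => w (enum_val i))) eig => //.
  move=> i j; rewrite A_mxE addr_ge0 // mulr_ge0 ?mulrn_wge0 // ?subr_ge0 //.
by move=> j; rewrite mul_A_mx.
Qed.

End Lambda.

Lemma F33_in_family : in_family 6 2 (F_graph 3 3).
Proof.
split; last first.
- apply/eqP; rewrite eqn_leq; apply/andP; split.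
    apply/bigmax_leqP => S /forall_inP indS.
    (* An independent set meets each of the two triangles at most once. *)
    pose side (x : F_graph 3 3) := if x is inl _ then true else false.
    have side_inj : {in S &, injective side}.
      move=> x y xS yS; have /forall_inP/(_ y yS) := indS x xS.
      by case: x {xS} => x; case: y {yS} => y //= /negPn/eqP->.
    by rewrite -(card_in_imset side_inj) (leq_trans (max_card _)) ?card_bool.
  (* Vertices numbered 2 are not ends of the bridge, so one from each triangle gives an independent
     pair. *)
  pose x : F_graph 3 3 := inl ord_max; pose y : F_graph 3 3 := inr ord_max.
  have card_xy : #|[set x; y]| = 2%N by rewrite cards2.
  rewrite -[X in (X <= _)%N]card_xy.
  apply: (@leq_bigmax_cond _ (@independent (F_graph 3 3)) (fun S => #|S|)).
  by apply/forall_inP => u /set2P[]->; apply/forall_inP => w /set2P[]->.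
- by rewrite card_sum !card_ord.
pose o : F_graph 3 3 := inl ord0; pose o' : F_graph 3 3 := inr ord0.
have conn_sym := sym_connect_sym (@adj_sym (F_graph 3 3)).
suff to_o x : connect (@adj (F_graph 3 3)) o x.
  by move=> x y; apply: connect_trans (to_o y); rewrite conn_sym.
case: x => i; last first.
  apply: (@connect_trans _ _ o'); first exact: connect1.
  by have [<-|ne] := eqVneq ord0 i; [apply: connect0 | apply: connect1].
by have [<-|ne] := eqVneq ord0 i; [apply: connect0 | apply: connect1].
Qed.

(** * The quadratic form on test vectors [b + c * e] *)

Section Forms.
Variables (R : realType) (sigma : R) (G : sgraph).
Implicit Types (b c : R) (e x : G -> R).

Lemma A_form_split x : A_form sigma x =
  sigma * (\sum_u (degree u)%:R * x u ^+ 2) +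
  (1 - sigma) * \sum_u \sum_v (adj u v)%:R * (x u * x v).
Proof.
rewrite !mulr_sumr -big_split /=; apply: eq_bigr => u _.
rewrite degree_sum !mulr_suml !mulr_sumr -big_split /=.
by apply: eq_bigr => v _; ring.
Qed.

Lemma sum_adj_degree x :
  \sum_u \sum_v (adj u v)%:R * x u = \sum_u (degree u)%:R * x u.
Proof. by apply: eq_bigr => u _; rewrite degree_sum mulr_suml. Qed.

Lemma A_form_affine b c e :
  A_form sigma (fun u => b + c * e u) =
  b ^+ 2 * (\sum_(u : G) degree u)%:R +
  2 * b * c * (\sum_u (degree u)%:R * e u) + c ^+ 2 * A_form sigma e.
Proof.
have -> : (\sum_(u : G) degree u)%:R = \sum_(u : G) \sum_v (adj u v)%:R :> R.
  by rewrite natr_sum; apply: eq_bigr => u _; rewrite degree_sum.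
have symE : \sum_u \sum_v (adj u v)%:R * e v = \sum_u (degree u)%:R * e u.
  rewrite exchange_big -sum_adj_degree /=.
  by apply: eq_bigr => u _; apply: eq_bigr => v _; rewrite adj_sym.
(* Expanding one summand gives [e u] the weight [1 + sigma] and [e v] the weight [1 - sigma]; by
   symmetry both have the same total over ordered adjacent pairs. *)
have -> : 2 * b * c * (\sum_u (degree u)%:R * e u) =
    (1 + sigma) * b * c * (\sum_u \sum_v (adj u v)%:R * e u) +
    (1 - sigma) * b * c * (\sum_u \sum_v (adj u v)%:R * e v).
  by rewrite symE sum_adj_degree; ring.
rewrite !mulr_sumr -!big_split /=; apply: eq_bigr => u _.
rewrite !mulr_sumr -!big_split /=; apply: eq_bigr => v _.
ring.
Qed.

Lemma lambda_gt x t : (0 < #|G|)%N ->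
  t * (\sum_v x v ^+ 2) < A_form sigma x -> t < lambda sigma G.
Proof.
move=> G_gt0 lt_t; have := lt_le_trans lt_t (lambda_rayleigh sigma x G_gt0).
have : 0 <= \sum_v x v ^+ 2 by apply: sumr_ge0 => v _; exact: sqr_ge0.
rewrite le_eqVlt => /predU1P[<-|sum_gt0]; first by rewrite !mulr0 ltxx.
by rewrite ltr_pM2r.
Qed.

Lemma sum_affine_sqr b c e :
  \sum_u (b + c * e u) ^+ 2 =
  #|G|%:R * b ^+ 2 + 2 * b * c * (\sum_u e u) + c ^+ 2 * \sum_u e u ^+ 2.
Proof.
rewrite mulr_natl -sumr_const !mulr_sumr -!big_split /=.
by apply: eq_bigr => u _; ring.
Qed.

End Forms.

(** * Comparison of [lambda] with the root [t] *)

Section Bounds.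
Variables (R : realType) (sigma : R).
Hypothesis hsigma : 0 <= sigma < 1.

(* The polynomial is (t - 1 - 2 sigma) (t - 1 - sigma) - 2 (1 - sigma)^2. *)
Lemma F33_root : exists t : R,
  [/\ t ^+ 2 - (2 + 3 * sigma) * t - 1 + 7 * sigma = 0, 1 + sigma < t &
      t < (5 + sigma) / 2].
Proof.
move: hsigma => /andP[s_ge0 s_lt1].
(* The discriminant, positive because [9 * d = (9 * sigma - 8) ^+ 2 + 8]. *)
pose d := 8 - 16 * sigma + 9 * sigma ^+ 2.
have d_gt0 : 0 < d by have := sqr_ge0 (9 * sigma - 8); rewrite /d; lra.
have := sqr_sqrtr (ltW d_gt0); have : 0 < Num.sqrt d by rewrite sqrtr_gt0.
move: (Num.sqrt d) => r r_gt0; rewrite /d => rE.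
exists ((2 + 3 * sigma + r) / 2); split.
- transitivity ((r ^+ 2 - (8 - 16 * sigma + 9 * sigma ^+ 2)) / 4).
    by field.
  by rewrite rE subrr mul0r.
- lra.
- suff : r < 3 - 2 * sigma by lra.
  (* This product is [(3 - 2 * sigma) ^+ 2 - d]. *)
  have pos : 0 < (1 - sigma) * (1 + 5 * sigma) by apply: mulr_gt0; lra.
  by rewrite -(ltr_pXn2r (n := 2)) ?nnegrE ?rE //; lra.
Qed.

Variable t : R.
Hypotheses (t_root : t ^+ 2 - (2 + 3 * sigma) * t - 1 + 7 * sigma = 0)
  (t_gt : 1 + sigma < t) (t_lt : t < (5 + sigma) / 2).

(** The eigenvector for [t]: away from the bridge the eigenvalue equation is an identity in [t], at
    the ends of the bridge it is [t_root]. *)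
Let w (i : F_graph 3 3) : R :=
  match i with inl i | inr i => if i == 0 :> nat then t - 1 - sigma
                                else 1 - sigma end.

Let w_eigen v :
  \sum_u (adj v u)%:R * (sigma * w v + (1 - sigma) * w u) = t * w v.
Proof.
rewrite big_sumType !big_ord_recl !big_ord0 /=.
case: v => [] [[|[|[|//]]] ?] /=;
  rewrite ?mul0r ?mul1r ?addr0 ?add0r;
    by [ring | rewrite -[RHS]subr0 -t_root; ring].
Qed.

Let w_gt0 v : 0 < w v.
Proof.
have /andP[_ s_lt1] := hsigma.
by case: v => i; rewrite /w; case: ifP => _; rewrite -?addrA -?opprD subr_gt0.
Qed.

Lemma lambda_F33_le : lambda sigma (F_graph 3 3) <= t.
Proof.
have /andP[s_ge0 s_lt1] := hsigma.
apply: (lambda_le (w := w)); first by rewrite s_ge0 ltW.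
- by rewrite card_sum !card_ord.
- exact: w_gt0.
- by move=> v; rewrite w_eigen.
Qed.

Variable G : sgraph.
Hypothesis cardG : #|G| = 6%N.

(** The eigenvector [w], transported along the isomorphism, has Rayleigh quotient exactly [t]. *)
Lemma lambda_F33_ge : isomorphic G (F_graph 3 3) -> t <= lambda sigma G.
Proof.
case=> f f_bij f_adj.
have := lambda_rayleigh sigma (w \o f); rewrite cardG => /(_ isT).
have -> : A_form sigma (w \o f) = t * \sum_x w (f x) ^+ 2.
  rewrite mulr_sumr; apply: eq_bigr => x _.
  transitivity (t * w (f x) * w (f x)); last by rewrite expr2 mulrA.
  rewrite -w_eigen (reindex f (onW_bij _ f_bij)) mulr_suml.
  by apply: eq_bigr => y _; rewrite f_adj /=; ring.
rewrite ler_pM2r //.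
have [x _] : exists x : G, x \in G by apply/card_gt0P; rewrite cardG.
rewrite (bigD1 x) //= ltr_pwDl ?exprn_gt0 //.
by rewrite sumr_ge0 // => y _; rewrite sqr_ge0.
Qed.

Lemma lambda_gt_dense : (18 <= \sum_(v : G) degree v)%N -> t < lambda sigma G.
Proof.
(* Local copies, since [lra] ignores section hypotheses. *)
have /andP[s_ge0 s_lt1] := hsigma; have lt_t := t_lt; have gt_t := t_gt.
(* The constant 1, written in affine shape; its quotient is at least 18 / 6 = 3, which exceeds
   [(5 + sigma) / 2]. *)
move=> D; apply: (@lambda_gt _ _ _ (fun=> 1 + 0 * 0)); first by rewrite cardG.
rewrite A_form_affine sum_affine_sqr cardG.
have : 18%:R <= (\sum_(v : G) degree v)%:R :> R by rewrite ler_nat.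
lra.
Qed.

(** The test vector has squared norm 9 and form at least [16 + 8 + 4 * sigma]; the quotient exceeds
    [(5 + sigma) / 2] since [sigma < 3]. *)
Lemma lambda_gt_degree4 (v : G) : (4 <= degree v)%N ->
  (16 <= \sum_(u : G) degree u)%N -> t < lambda sigma G.
Proof.
have /andP[s_ge0 s_lt1] := hsigma; have lt_t := t_lt; have gt_t := t_gt.
move=> dv D; pose e u : R := (u == v)%:R.
have sum_e (F : G -> R) : \sum_u F u * e u = F v.
  rewrite (bigD1 v) //= /e eqxx mulr1 big1 ?addr0 // => u /negPf->.
  by rewrite mulr0.
have e_sqr u : e u ^+ 2 = e u by rewrite /e; case: eqP; rewrite ?expr1n ?expr0n.
apply: (@lambda_gt _ _ _ (fun u => 1 + 1 * e u)); first by rewrite cardG.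
rewrite A_form_affine sum_affine_sqr cardG sum_e.
have -> : \sum_u e u = 1.
  by rewrite -(sum_e (fun=> 1)); apply: eq_bigr => u _; rewrite mul1r.
have -> : \sum_u e u ^+ 2 = 1.
  by rewrite -(sum_e (fun=> 1)); apply: eq_bigr => u _; rewrite mul1r.
have -> : A_form sigma e = sigma * (degree v)%:R.
  rewrite A_form_split; under eq_bigr do rewrite e_sqr.
  rewrite sum_e [X in (1 - _) * X]big1 ?mulr0 ?addr0 // => u _.
  under eq_bigr do rewrite mulrA.
  by rewrite sum_e /e; case: eqP => [->|_]; rewrite ?adj_irr ?mul0r ?mulr0.
have : 16%:R <= (\sum_(v : G) degree v)%:R :> R by rewrite ler_nat.
have : 4%:R <= (degree v)%:R :> R by rewrite ler_nat.
nra.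
Qed.

(** Four vertices have degree 3 and two have degree 2. The constant vector gives only 8 / 3, too
    small for [sigma] near 1, where [t] approaches 3; hence a test vector depending on [t]. *)
Lemma lambda_gt_degrees23 : \sum_(v : G) degree v = 16%N ->
  (forall v : G, 2 <= degree v <= 3)%N -> t < lambda sigma G.
Proof.
have /andP[s_ge0 s_lt1] := hsigma; have lt_t := t_lt; have gt_t := t_gt.
move=> D deg23; pose e (u : G) : R := (degree u)%:R - 2.
have e01 u : e u = 0 \/ e u = 1.
  rewrite /e; case: (degree u) (deg23 u) => [|[|[|[|//]]]] // _.
    by left; rewrite subrr.
  by right; ring.
have degE u : (degree u)%:R = 2 + e u by rewrite /e; ring.
have sum_e : \sum_u e u = 4.
  rewrite sumrB -natr_sum D sumr_const -[#|_|]/#|G| cardG; ring.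
have e_sqr u : e u ^+ 2 = e u by case: (e01 u) => ->; ring.
have sum_deg_e : \sum_u (degree u)%:R * e u = 12.
  transitivity (\sum_u 3 * e u); last by rewrite -mulr_sumr sum_e; ring.
  by apply: eq_bigr => u _; rewrite degE; case: (e01 u) => ->; ring.
pose E := \sum_u \sum_v (adj u v)%:R * (e u * e v).
have E_ge8 : 8 <= E.
  (* [E - 8] counts the ordered pairs of adjacent vertices of degree 2. *)
  have := A_form_affine 0 1 (-1) e.
  rewrite !A_form_split !mul0r !add0r subr0 !mul1r sum_deg_e D -/E => affE.
  suff : 0 <= \sum_u \sum_v (adj u v)%:R * ((1 + -1 * e u) * (1 + -1 * e v)).
    by rewrite affE; lra.
  apply: sumr_ge0 => u _; apply: sumr_ge0 => v _.
  have e_le1 z : 0 <= 1 + -1 * e z by case: (e01 z) => ->; lra.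
  by rewrite !mulr_ge0.
(* With the value [b + c = t - 2 * sigma] on degree 3 fixed, [b] maximizes the
   form minus [t] times the squared norm when [E = 8]. *)
pose b := 2 * (1 - sigma); pose c := t - 2 * sigma - b.
apply: (@lambda_gt _ _ _ (fun u => b + c * e u)); first by rewrite cardG.
rewrite A_form_affine sum_affine_sqr cardG sum_deg_e D A_form_split -/E sum_e.
under eq_bigr do rewrite e_sqr.
under [X in sigma * X]eq_bigr do rewrite e_sqr.
rewrite sum_e sum_deg_e -subr_gt0.
(* The last term vanishes by [t_root], the middle one is nonnegative by [E_ge8], and the first is
   positive since [t > 1 + sigma > 2 * sigma]. *)
have -> : b ^+ 2 * 16%:R + 2 * b * c * 12 +
    c ^+ 2 * (sigma * 12 + (1 - sigma) * E) -
    t * (6%:R * b ^+ 2 + 2 * b * c * 4 + c ^+ 2 * 4) =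
    4 * (t - 2 * sigma) * (1 - sigma) + c ^+ 2 * (1 - sigma) * (E - 8) -
    4 * (t - 2 * sigma) * (t ^+ 2 - (2 + 3 * sigma) * t - 1 + 7 * sigma).
  by rewrite /c /b; ring.
rewrite t_root mulr0 subr0 ltr_pwDl //.
  by rewrite !mulr_gt0 ?subr_gt0 //; lra.
by rewrite -mulrA mulr_ge0 ?sqr_ge0 // mulr_ge0 ?subr_ge0 // ltW.
Qed.

End Bounds.

Theorem theorem5p8 (R : realType) (sigma : R) (hsigma : 0 <= sigma < 1) :
  minimizer sigma 6 2 (F_graph 3 3) /\
  forall G : sgraph, minimizer sigma 6 2 G -> isomorphic G (F_graph 3 3).
Proof.
have [t [t_root t_gt t_lt]] := F33_root hsigma.
have F_le := lambda_F33_le hsigma t_root t_gt.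
(* This dichotomy serves both claims: it bounds [lambda] below by [t] on the whole family, and
   strictly off the isomorphism class. *)
have iso_or_gt G : in_family 6 2 G ->
    isomorphic G (F_graph 3 3) \/ t < lambda sigma G.
  move=> famG; have [_ cardG _] := famG.
  have [|dense] := F33_or_8_edges famG; first by left.
  right; case: dense => [[D [v dv]]|D|[D deg23]].
  - exact: lambda_gt_degree4 dv D.
  - exact: lambda_gt_dense D.
  - exact: lambda_gt_degrees23 D deg23.
split=> [|G [famG minG]].
  split=> [|G famG]; first exact: F33_in_family.
  apply: le_trans F_le _; have [_ cardG _] := famG.
  have [iso|/ltW//] := iso_or_gt G famG.
  exact: lambda_F33_ge iso.
have [//|gt_t] := iso_or_gt G famG.
have := le_lt_trans (le_trans (minG _ F33_in_family) F_le) gt_t.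
by rewrite ltxx.
Qed.
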